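(* Suppose $K<m$. Let $(\mathbf x^*,s^*,\hat{\boldsymbol\lambda}^*,\mathbf q',\mathbf Q')$ be an optimal solution of the problem (SDP) defined in the context, with optimal value $\Theta_{\mathrm M}(m)$, for which there are $\mathbf V\in\mathbb R^{m\times K}$ with orthonormal columns, $\mathbf Y_{11}\in\mathbb R^{K\times K}$ with $\mathbf Y_{11}\succeq 0$, $\boldsymbol\delta\in\mathbb R^K$ and $\boldsymbol\nu_k\in\mathbb R^K$ ($k\in[K]$) such that $\operatorname{rank}(\mathbf Q')\le K$, $\mathbf q'=\mathbf V\boldsymbol\delta$, $\mathbf Q'=\mathbf V\mathbf Y_{11}\mathbf V^\top$ and $(\mathbf U\boldsymbol\Lambda^{1/2})^\top(\mathbf A^\top\boldsymbol\lambda_k^*-y_k(\mathbf x^* ))=\mathbf V\boldsymbol\nu_k$ for all $k\in[K]$. If $K\le m_1\le m$, then $$\Theta_{\mathrm U}(m_1)=\Theta_{\mathrm M}(m),$$ where $\Theta_{\mathrm U}(m_1)=\min_{\mathbf B\in\mathcal B_{m_1}}\overline\Theta(m_1,\mathbf B)$ and $\overline\Theta(m_1,\mathbf B)$ is the optimal value of the problem (U$_{\mathbf B}$) defined in the context. Specifically, when $m_1=K$, there is an optimal solution of the problem defining $\Theta_{\mathrm U}(K)$ (the joint minimization of (U$_{\mathbf B}$) over $\mathbf B\in\mathcal B_K$ and the variables of (U$_{\mathbf B}$)) with $\mathbf B=\mathbf V$ and $\mathbf Q_{\mathrm r}=\mathbf Y_{11}$, so that $\Theta_{\mathrm U}(m_1)=\overline\Theta(m_1,\mathbf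 V)$.
   Context: Setting. $[N]=\{1,\dots,N\}$; $m,n,l,K$ are positive integers; $\gamma_1\ge 0$, $\gamma_2\ge 1$; $\boldsymbol\mu\in\mathbb R^m$; $\boldsymbol\Sigma\in\mathbb R^{m\times m}$ is symmetric positive definite with eigenvalue decomposition $\boldsymbol\Sigma=\mathbf U\boldsymbol\Lambda\mathbf U^\top$, $\mathbf U$ orthogonal, $\boldsymbol\Lambda$ diagonal with nonincreasing diagonal entries. $\mathcal X\subseteq\mathbb R^n$. $\mathbf A\in\mathbb R^{l\times m}$ and $\mathbf b\in\mathbb R^l$ are such that $\{\boldsymbol\xi\in\mathbb R^m:\mathbf A\boldsymbol\xi\le\mathbf b\}$ has at least one interior point. For $k\in[K]$, $y_k^0(\mathbf x)\in\mathbb R$ and $y_k(\mathbf x)\in\mathbb R^m$ are affine in $\mathbf x\in\mathbb R^n$. $\mathcal B_{m_1}=\{\mathbf B\in\mathbb R^{m\times m_1}:\mathbf B^\top\mathbf B=\mathbf I_{m_1}\}$. $\mathbf M\succeq0$ means $\mathbf M$ is (symmetric) positive semidefinite; $\mathbf A\bullet\mathbf B=\sum_{i,j}A_{ij}B_{ij}$. Optimal values of minimization problems are infima. Problem (SDP): minimize $s+\gamma_2\,\mathbf I_m\bullet\mathbf Q+\sqrt{\gamma_1}\,\|\mathbf q\|_2$ over $\mathbf x\in\mathcal X$, $s\in\mathbb R$, $\hat{\boldsymbol\lambda}=\{\boldsymbol\lambda_1,\dots,\boldsymbol\lambda_K\}$ with $\boldsymbol\lambda_k\in\mathbb R^l_+$,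 $\mathbf q\in\mathbb R^m$, $\mathbf Q\in\mathbb R^{m\times m}$, subject to, for all $k\in[K]$, $$\begin{bmatrix} s-y_k^0(\mathbf x)-\boldsymbol\lambda_k^\top\mathbf b-y_k(\mathbf x)^\top\boldsymbol\mu+\boldsymbol\lambda_k^\top\mathbf A\boldsymbol\mu & \frac12\left(\mathbf q+(\mathbf U\boldsymbol\Lambda^{1/2})^\top(\mathbf A^\top\boldsymbol\lambda_k-y_k(\mathbf x))\right)^\top\\ \frac12\left(\mathbf q+(\mathbf U\boldsymbol\Lambda^{1/2})^\top(\mathbf A^\top\boldsymbol\lambda_k-y_k(\mathbf x))\right)&\mathbf Q\end{bmatrix}\succeq0 .$$ For $\mathbf B\in\mathcal B_{m_1}$, problem (U$_{\mathbf B}$): minimize $s+\gamma_2\,\mathbf I_{m_1}\bullet\mathbf Q_{\mathrm r}+\sqrt{\gamma_1}\,\|\mathbf q\|_2$ over $\mathbf x\in\mathcal X$, $s\in\mathbb R$, $\boldsymbol\lambda_k\in\mathbb R^l_+$ and $\mathbf u_k\in\mathbb R^{m_1}$ ($k\in[K]$), $\mathbf q\in\mathbb R^m$, $\mathbf Q_{\mathrm r}\in\mathbb R^{m_1\times m_1}$, subject to, for all $k\in[K]$, $$\begin{bmatrix} s-y_k^0(\mathbf x)-\boldsymbol\lambda_k^\top\mathbf b-y_k(\mathbf x)^\top\boldsymbol\mu+\boldsymbol\lambda_k^\top\mathbf A\boldsymbol\mu & \frac12\mathbf u_k^\top\\ \frac12\mathbf u_k&\mathbf Q_{\mathrm r}\end{bmatrix}\succeq0,\qquad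 \mathbf q+(\mathbf U\boldsymbol\Lambda^{1/2})^\top(\mathbf A^\top\boldsymbol\lambda_k-y_k(\mathbf x))=\mathbf B\mathbf u_k .$$ *)

(* Defs.v *)
From HB Require Import structures.
From mathcomp Require Export all_boot all_order all_algebra.
From mathcomp Require Export all_classical all_reals all_analysis.

Set Implicit Arguments.
Unset Strict Implicit.
Unset Printing Implicit Defensive.

Import Order.TTheory GRing.Theory Num.Theory.
Import numFieldNormedType.Exports.

Local Open Scope classical_set_scope.
Local Open Scope ring_scope.

Definition psd (R : realType) (p : nat) (M : 'M[R]_p) : Prop :=
  M^T = M /\ forall v : 'cV[R]_p, 0 <= (v^T *m M *m v) 0 0.

Definition posdef (R : realType) (p : nat) (M : 'M[R]_p) : Prop :=
  M^T = M /\ forall v : 'cV[R]_p, v != 0 -> 0 < (v^T *m M *m v) 0 0.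

Definition frob (R : realType) (p r : nat) (A B : 'M[R]_(p, r)) : R :=
  \sum_i \sum_j A i j * B i j.

(* The library norm on matrices is the sup norm, hence this definition. *)
Definition norm2 (R : realType) (p : nat) (v : 'cV[R]_p) : R :=
  Num.sqrt (\sum_i v i 0 ^+ 2).

Definition is_affine (R : realType) (V W : lmodType R) (f : V -> W) : Prop :=
  exists (g : {linear V -> W}) (c : W), forall x, f x = g x + c.

Definition orthonormal_cols (R : realType) (p r : nat) : set 'M[R]_(p, r) :=
  [set B | B^T *m B = 1%:M].

Definition nonneg_vec (R : realType) (p : nat) (v : 'cV[R]_p) : Prop :=
  forall i, 0 <= v i 0.

Definition polyhedron (R : realType) (p r : nat) (A : 'M[R]_(r, p))
    (b : 'cV[R]_r) : set 'cV[R]_p :=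
  [set xi | forall i, (A *m xi) i 0 <= b i 0].

(* The infimum is taken in the extended reals: +oo if there is no feasible
   point, -oo if the problem is unbounded. *)
Definition optimal_value (R : realType) (T : Type) (feasible : set T)
    (objective : T -> R) : \bar R :=
  ereal_inf [set (objective z)%:E | z in feasible].

Definition optimal_solution (R : realType) (T : Type) (feasible : set T)
    (objective : T -> R) (z : T) : Prop :=
  feasible z /\ forall w, feasible w -> objective z <= objective w.

(* [Lambda] is the row vector of the diagonal entries of the eigenvalue
   matrix. *)
Record instance (R : realType) (m n l K : nat) := Instance {
  gamma1 : R;
  gamma2 : R;
  mu : 'cV[R]_m;
  Sigma : 'M[R]_m;
  U : 'M[R]_m;
  Lambda : 'rV[R]_m;
  X : set 'cV[R]_n;
  A : 'M[R]_(l, m);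
  b : 'cV[R]_l;
  y0 : 'I_K -> 'cV[R]_n -> R;
  y : 'I_K -> 'cV[R]_n -> 'cV[R]_m
}.

Record standing_assumptions (R : realType) (m n l K : nat)
    (P : instance R m n l K) : Prop := StandingAssumptions {
  gamma1_ge0 : 0 <= gamma1 P;
  gamma2_ge1 : 1 <= gamma2 P;
  Sigma_posdef : posdef (Sigma P);
  U_orthogonal : orthonormal_cols (U P);
  Sigma_eig : Sigma P = U P *m diag_mx (Lambda P) *m (U P)^T;
  Lambda_nonincr : forall i j : 'I_m, (i <= j)%N -> Lambda P 0 j <= Lambda P 0 i;
  support_interior : interior (polyhedron (A P) (b P)) !=set0;
  y0_affine : forall k, is_affine (y0 P k : 'cV[R]_n -> R^o);
  y_affine : forall k, is_affine (y P k)
}.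

Section Problems.
Context (R : realType) (m n l K : nat) (P : instance R m n l K).

Definition ULsqrt : 'M[R]_m := U P *m diag_mx (map_mx Num.sqrt (Lambda P)).

Definition corner (x : 'cV[R]_n) (s : R) (lambda : 'cV[R]_l) (k : 'I_K) : 'M[R]_1 :=
  s%:M - (y0 P k x)%:M - lambda^T *m b P - (y P k x)^T *m mu P
  + lambda^T *m A P *m mu P.

Definition shift (x : 'cV[R]_n) (lambda : 'cV[R]_l) (k : 'I_K) : 'cV[R]_m :=
  ULsqrt^T *m ((A P)^T *m lambda - y P k x).

Definition lmi_mx (r : nat) (a : 'M[R]_1) (w : 'cV[R]_r) (Q : 'M[R]_r) :
    'M[R]_(1 + r) :=
  block_mx a (2^-1 *: w^T) (2^-1 *: w) Q.

Record sdp_var := SdpVar {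
  sdp_x : 'cV[R]_n;
  sdp_s : R;
  sdp_lambda : 'I_K -> 'cV[R]_l;
  sdp_q : 'cV[R]_m;
  sdp_Q : 'M[R]_m
}.

Definition sdp_feasible : set sdp_var := [set z |
  [/\ X P (sdp_x z),
      forall k, nonneg_vec (sdp_lambda z k) &
      forall k, psd (lmi_mx (corner (sdp_x z) (sdp_s z) (sdp_lambda z k) k)
                            (sdp_q z + shift (sdp_x z) (sdp_lambda z k) k)
                            (sdp_Q z))]].

Definition sdp_objective (z : sdp_var) : R :=
  sdp_s z + gamma2 P * frob 1%:M (sdp_Q z) + Num.sqrt (gamma1 P) * norm2 (sdp_q z).

Definition Theta_M : \bar R := optimal_value sdp_feasible sdp_objective.

Record u_var (m1 : nat) := UVar {
  u_x : 'cV[R]_n;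
  u_s : R;
  u_lambda : 'I_K -> 'cV[R]_l;
  u_u : 'I_K -> 'cV[R]_m1;
  u_q : 'cV[R]_m;
  u_Qr : 'M[R]_m1
}.

Definition u_feasible (m1 : nat) (B : 'M[R]_(m, m1)) : set (u_var m1) := [set z |
  [/\ X P (u_x z),
      forall k, nonneg_vec (u_lambda z k),
      forall k, psd (lmi_mx (corner (u_x z) (u_s z) (u_lambda z k) k)
                            (u_u z k) (u_Qr z)) &
      forall k, u_q z + shift (u_x z) (u_lambda z k) k = B *m u_u z k]].

Definition u_objective (m1 : nat) (z : u_var m1) : R :=
  u_s z + gamma2 P * frob 1%:M (u_Qr z) + Num.sqrt (gamma1 P) * norm2 (u_q z).

Definition Theta_bar (m1 : nat) (B : 'M[R]_(m, m1)) : \bar R :=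
  optimal_value (u_feasible B) (@u_objective m1).

Definition Theta_U (m1 : nat) : \bar R :=
  ereal_inf [set Theta_bar B | B in @orthonormal_cols R m m1].

Definition joint_feasible (m1 : nat) : set ('M[R]_(m, m1) * u_var m1) :=
  [set Bz | orthonormal_cols Bz.1 /\ u_feasible Bz.1 Bz.2].

Definition joint_objective (m1 : nat) (Bz : 'M[R]_(m, m1) * u_var m1) : R :=
  u_objective Bz.2.

End Problems.

(* Main.v *)
Require Import Defs.

(** A feasible point of (U_B) is a feasible point of (SDP) in disguise: the LMI
    of (SDP) with data [B u] and [B Qr B^T] is a congruence transform, by the
    block-diagonal matrix of 1 and [B], of the LMI of (U_B) with data [u] and
    [Qr], and the trace, hence the objective, does not change since
    [B^T B = 1].  So no problem (U_B) goes below the optimum of (SDP)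
    ([sdp_optimum_le_u]).

    Conversely, the congruence by [B^T] compresses a point of (SDP) to one of
    (U_B).  This loses nothing provided that the matrix [Q] and the vectors in
    the borders of the LMIs live in the column space of [B], on which the
    orthogonal projector [B B^T] is the identity ([u_feasible_compress]).  The
    hypotheses on the optimal solution say that these data live in the column
    space of [V], so every [B] with [B B^T V = V] attains the optimum of (SDP).
    Such a [B] with [m1] columns exists whenever [K <= m1 <= m], because an
    orthonormal family can be extended one vector at a time
    ([extend_orthonormal]); for [m1 = K] one takes [B = V], and the compressed
    matrix is then [V^T (V Y11 V^T) V = Y11]. *)

Import Order.TTheory GRing.Theory Num.Theory.

Set Implicit Arguments.
Unset Strict Implicit.
Unset Printing Implicit Defensive.

Local Open Scope classical_set_scope.
Local Open Scope ring_scope.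

Lemma optimal_valueE (R : realType) (T : Type) (feasible : set T)
    (objective : T -> R) (z : T) :
  optimal_solution feasible objective z ->
  optimal_value feasible objective = (objective z)%:E.
Proof.
case=> fz zmin; apply/eqP; rewrite eq_le; apply/andP; split.
  by apply: ereal_inf_lbound; exists z.
by apply: le_ereal_inf_tmp => _ [w fw <-]; rewrite lee_fin zmin.
Qed.

Lemma frob1E (R : realType) (p : nat) (M : 'M[R]_p) : frob 1%:M M = \tr M.
Proof.
apply: eq_bigr => i _; rewrite (bigD1 i) //= big1 ?addr0.
  by rewrite !mxE eqxx mul1r.
by move=> j ji; rewrite !mxE eq_sym (negbTE ji) mul0r.
Qed.

Lemma psd_congruence (R : realType) (p r : nat) (M : 'M[R]_(r, p))
    (Q : 'M[R]_p) : psd Q -> psd (M *m Q *m M^T).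
Proof.
case=> symQ posQ; split; first by rewrite !trmx_mul trmxK symQ mulmxA.
move=> v; have := posQ (M^T *m v).
by rewrite trmx_mul trmxK !mulmxA.
Qed.

(** This is the congruence of the LMI matrix by the block-diagonal matrix of 1
    and [M], which leaves the corner alone. *)
Lemma psd_lmi_congruence (R : realType) (p r : nat) (M : 'M[R]_(r, p))
    (a : 'M[R]_1) (w : 'cV[R]_p) (Q : 'M[R]_p) :
  psd (lmi_mx a w Q) -> psd (lmi_mx a (M *m w) (M *m Q *m M^T)).
Proof.
move=> /(psd_congruence (block_mx 1%:M 0 0 M)).
rewrite /lmi_mx tr_block_mx !mulmx_block !trmx0 !trmx1.
rewrite !(mul0mx, mulmx0, mul1mx, mulmx1, addr0, add0r).
by rewrite -scalemxAl -scalemxAr trmx_mul.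
Qed.

(** The left kernel of [B] is nonzero for dimension reasons, and any nonzero
    row in it can be normalized. *)
Lemma unit_orthogonal_vector (R : realType) (p r : nat) (B : 'M[R]_(p, r)) :
  (r < p)%N -> exists e : 'cV[R]_p, e^T *m e = 1%:M /\ e^T *m B = 0.
Proof.
move=> ltrp; pose v := nz_row (kermx B).
have v_neq0 : v != 0.
  rewrite nz_row_eq0 -mxrank_eq0 mxrank_ker -lt0n subn_gt0.
  exact: leq_ltn_trans (rank_leq_col B) ltrp.
have vB : v *m B = 0 by apply/sub_kermxP; exact: nz_row_sub.
pose c := (v *m v^T) 0 0.
have c_gt0 : 0 < c.
  have [j vj] : exists j, v 0 j != 0 by apply/rV0Pn.
  rewrite /c mxE (bigD1 j) //= ltr_wpDr //.
    by apply: sumr_ge0 => i _; rewrite mxE -expr2 sqr_ge0.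
  by rewrite mxE -expr2 lt_def sqr_ge0 expf_neq0.
exists ((Num.sqrt c)^-1 *: v^T).
have -> : ((Num.sqrt c)^-1 *: v^T)^T = (Num.sqrt c)^-1 *: v.
  by rewrite linearZ /= trmxK.
rewrite -!scalemxAl vB.
rewrite scaler0 -scalemxAr scalerA [v *m v^T]mx11_scalar -/c scale_scalar_mx.
split=> //; congr _%:M.
by rewrite -invfM -expr2 sqr_sqrtr ?(ltW c_gt0) // mulVf ?gt_eqF.
Qed.

(** The conclusion [B B^T V = V] says that the column space of [B] contains
    that of [V]; in this form it survives the addition of a column. *)
Lemma extend_orthonormal (R : realType) (p r r' : nat) (V : 'M[R]_(p, r)) :
  orthonormal_cols V -> (r <= r' <= p)%N ->
  exists2 B : 'M[R]_(p, r'), orthonormal_cols B & B *m B^T *m V = V.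
Proof.
move=> V_orth /andP[]; elim: r' => [|r' IHr'].
  rewrite leqn0 => /eqP r0 _; subst r.
  by exists V => //; rewrite -mulmxA V_orth mulmx1.
rewrite leq_eqVlt => /orP[/eqP rE _|ler lep].
  by subst r; exists V => //; rewrite -mulmxA V_orth mulmx1.
have [B B_orth BV] := IHr' ler (ltnW lep).
have [e [ee eB]] := unit_orthogonal_vector B lep.
have Be : B^T *m e = 0 by apply: trmx_inj; rewrite trmx_mul trmxK eB trmx0.
have C_orth : (row_mx e B)^T *m row_mx e B = 1%:M.
  by rewrite tr_row_mx mul_col_row ee eB Be B_orth -scalar_mx_block.
(* The new vector is orthogonal to [B], hence to [V = B B^T V]. *)
have eV : e^T *m V = 0 by rewrite -BV !mulmxA eB !mul0mx.
have CV : row_mx e B *m (row_mx e B)^T *m V = V.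
  by rewrite tr_row_mx mul_row_col mulmxDl BV -mulmxA eV mulmx0 add0r.
by exists (row_mx e B).
Qed.

Section LiftCompress.
Context (R : realType) (m n l K : nat) (P : instance R m n l K).

Definition lift_var (m1 : nat) (B : 'M[R]_(m, m1)) (w : u_var R m n l K m1) :
    sdp_var R m n l K :=
  SdpVar (u_x w) (u_s w) (u_lambda w) (u_q w) (B *m u_Qr w *m B^T).

Lemma sdp_feasible_lift (m1 : nat) (B : 'M[R]_(m, m1))
    (w : u_var R m n l K m1) :
  u_feasible P B w -> sdp_feasible P (lift_var B w).
Proof.
case=> Xw lambda_ge0 lmi eqBu; split=> //= k.
by rewrite eqBu; apply: psd_lmi_congruence.
Qed.

Lemma sdp_objective_lift (m1 : nat) (B : 'M[R]_(m, m1))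
    (w : u_var R m n l K m1) :
  orthonormal_cols B -> sdp_objective P (lift_var B w) = u_objective P w.
Proof.
move=> B_orth; rewrite /sdp_objective /u_objective /= !frob1E.
by rewrite mxtrace_mulC mulmxA B_orth mul1mx.
Qed.

Definition compress_var (m1 : nat) (B : 'M[R]_(m, m1))
    (z : sdp_var R m n l K) : u_var R m n l K m1 :=
  UVar (sdp_x z) (sdp_s z) (sdp_lambda z)
    (fun k => B^T *m (sdp_q z + shift P (sdp_x z) (sdp_lambda z k) k))
    (sdp_q z) (B^T *m sdp_Q z *m B).

(** The LMIs of (U_B) hold for every compressed point; the hypothesis serves the
    equality constraint, whose right-hand side becomes [B B^T w]. *)
Lemma u_feasible_compress (m1 : nat) (B : 'M[R]_(m, m1))
    (z : sdp_var R m n l K) :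
  (forall k, let w := sdp_q z + shift P (sdp_x z) (sdp_lambda z k) k in
     B *m B^T *m w = w) ->
  sdp_feasible P z -> u_feasible P B (compress_var B z).
Proof.
move=> projw [Xz lambda_ge0 lmi]; split=> //= k.
  by rewrite -[X in _ *m sdp_Q z *m X]trmxK; apply: psd_lmi_congruence.
by rewrite mulmxA projw.
Qed.

(** The trace of [B^T Q B] is that of [B B^T Q]. *)
Lemma u_objective_compress (m1 : nat) (B : 'M[R]_(m, m1))
    (z : sdp_var R m n l K) :
  B *m B^T *m sdp_Q z = sdp_Q z ->
  u_objective P (compress_var B z) = sdp_objective P z.
Proof.
move=> projQ; rewrite /sdp_objective /u_objective /= !frob1E.
by rewrite mxtrace_mulC mulmxA projQ.
Qed.

Lemma sdp_optimum_le_u (m1 : nat) (B : 'M[R]_(m, m1)) (z : sdp_var R m n l K)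
    (w : u_var R m n l K m1) :
  optimal_solution (sdp_feasible P) (sdp_objective P) z ->
  orthonormal_cols B -> u_feasible P B w ->
  sdp_objective P z <= u_objective P w.
Proof.
move=> [_ zmin] B_orth fw; rewrite -(sdp_objective_lift w B_orth).
exact/zmin/sdp_feasible_lift.
Qed.

Lemma compress_optimal (m1 : nat) (B : 'M[R]_(m, m1)) (z : sdp_var R m n l K) :
  optimal_solution (sdp_feasible P) (sdp_objective P) z ->
  orthonormal_cols B ->
  (forall k, let w := sdp_q z + shift P (sdp_x z) (sdp_lambda z k) k in
     B *m B^T *m w = w) ->
  B *m B^T *m sdp_Q z = sdp_Q z ->
  optimal_solution (u_feasible P B) (@u_objective _ _ _ _ _ P m1)
    (compress_var B z).
Proof.
move=> z_opt B_orth projw projQ; split.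
  by apply: u_feasible_compress => //; case: z_opt.
by move=> w fw; rewrite u_objective_compress // (sdp_optimum_le_u z_opt B_orth).
Qed.

Lemma Theta_M_le_Theta_U (m1 : nat) (z : sdp_var R m n l K) :
  optimal_solution (sdp_feasible P) (sdp_objective P) z ->
  (Theta_M P <= Theta_U P m1)%E.
Proof.
move=> z_opt; rewrite /Theta_M (optimal_valueE z_opt).
apply: le_ereal_inf_tmp => _ [B B_orth <-].
apply: le_ereal_inf_tmp => _ [w fw <-].
by rewrite lee_fin (sdp_optimum_le_u z_opt B_orth).
Qed.

End LiftCompress.

Theorem theorem5 (R : realType) (m n l K : nat) (P : instance R m n l K)
    (m_gt0 : (0 < m)%N) (n_gt0 : (0 < n)%N) (l_gt0 : (0 < l)%N) (K_gt0 : (0 < K)%N)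
    (hP : standing_assumptions P) (K_lt_m : (K < m)%N)
    (z : sdp_var R m n l K)
    (V : 'M[R]_(m, K)) (Y11 : 'M[R]_K)
    (delta : 'cV[R]_K) (nu : 'I_K -> 'cV[R]_K)
    (z_opt : optimal_solution (sdp_feasible P) (sdp_objective P) z)
    (V_orth : orthonormal_cols V) (Y11_psd : psd Y11)
    (rank_Q : (\rank (sdp_Q z) <= K)%N)
    (q_eq : sdp_q z = V *m delta)
    (Q_eq : sdp_Q z = V *m Y11 *m V^T)
    (shift_eq : forall k : 'I_K,
       (ULsqrt P)^T *m ((A P)^T *m sdp_lambda z k - y P k (sdp_x z)) = V *m nu k) :
  (forall m1 : nat, (K <= m1 <= m)%N -> Theta_U P m1 = Theta_M P) /\
  (exists w : u_var R m n l K K,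
     u_Qr w = Y11 /\
     optimal_solution (joint_feasible P (m1 := K)) (joint_objective P (m1 := K)) (V, w)) /\
  Theta_U P K = Theta_bar P V.
Proof.
have projw (m1 : nat) (B : 'M[R]_(m, m1)) : B *m B^T *m V = V ->
    forall k, let w := sdp_q z + shift P (sdp_x z) (sdp_lambda z k) k in
      B *m B^T *m w = w.
  by move=> BV k /=; rewrite /shift shift_eq q_eq -mulmxDr mulmxA BV.
have projQ (m1 : nat) (B : 'M[R]_(m, m1)) : B *m B^T *m V = V ->
    B *m B^T *m sdp_Q z = sdp_Q z.
  by move=> BV; rewrite Q_eq !mulmxA BV.
have Theta_barE (m1 : nat) (B : 'M[R]_(m, m1)) :
    orthonormal_cols B -> B *m B^T *m V = V -> Theta_bar P B = Theta_M P.
  move=> B_orth BV; rewrite /Theta_M (optimal_valueE z_opt).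
  rewrite -(u_objective_compress P (projQ _ _ BV)).
  by apply/optimal_valueE/compress_optimal => //; [exact: projw | exact: projQ].
have VV : V *m V^T *m V = V by rewrite -mulmxA V_orth mulmx1.
have Theta_UE (m1 : nat) : (K <= m1 <= m)%N -> Theta_U P m1 = Theta_M P.
  move=> le_m1; apply/eqP; rewrite eq_le (Theta_M_le_Theta_U _ z_opt) andbT.
  have [B B_orth BV] := extend_orthonormal V_orth le_m1.
  by rewrite -(Theta_barE _ B B_orth BV); apply: ereal_inf_lbound; exists B.
split=> //; split; last by rewrite Theta_UE ?leqnn ?(ltnW K_lt_m) // Theta_barE.
exists (compress_var P V z); split.
  by rewrite /= Q_eq !mulmxA V_orth mul1mx -mulmxA V_orth mulmx1.
split.
  split=> //; apply: u_feasible_compress; first exact: projw.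
  by case: z_opt.
case=> B w [/= B_orth fw]; rewrite /joint_objective /=.
by rewrite u_objective_compress ?projQ // (sdp_optimum_le_u z_opt B_orth).
Qed.
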